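(* Let $n$ be a positive integer, let $a,b$ be real numbers with $1\le a<b\le n$, and set $I=[a,b]\cap\mathbb{N}$. Let $Q(\lambda)=\lambda\log\lambda-\lambda+1$, with $Q(0)=1$. (1) Uniformly for $0\le\lambda\le1$, \[ \mathbb{P}\big(C_I(\sigma)\le\lambda\log(b/a)\big)=O\big((b/a)^{-Q(\lambda)}\big). \] (2) Let $\lambda_0>1$. Uniformly for $1\le\lambda\le\lambda_0$, \[ \mathbb{P}\big(C_I(\sigma)\ge\lambda\log(b/a)\big)=O_{\lambda_0}\big((b/a)^{-Q(\lambda)}\big). \] (3) In particular, uniformly for $0\le\psi\le\sqrt{\log(b/a)}$, \[ \mathbb{P}\left(|C_I(\sigma)-\log(b/a)|\ge\psi\sqrt{\log(b/a)}\right)=O\big(e^{-\frac13\psi^2}\big). \]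
   Context: The probability $\mathbb{P}$ is with respect to a uniformly random permutation $\sigma$ in the symmetric group $\mathcal{S}_n$ on $[n]=\{1,\ldots,n\}$. For $I\subseteq[n]$, $C_I(\sigma)$ is the number of cycles of $\sigma$ whose lengths lie in $I$ (fixed points count as cycles of length 1). $0\log0=0$. The notation $f=O(g)$ means that there is a constant $C>0$ with $|f|\le Cg$ throughout the stated domain; the constants in (1) and (3) are absolute (independent of $n,a,b,\lambda,\psi$), and the constant in (2) depends only on $\lambda_0$. *)

(* Defs.v *)
From HB Require Import structures.
From mathcomp Require Import all_boot all_order all_algebra all_fingroup.
From mathcomp Require Import reals sequences exp.
Set Implicit Arguments.
Unset Strict Implicit.
Unset Printing Implicit Defensive.
Import Order.TTheory GRing.Theory Num.Theory.
Local Open Scope ring_scope.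

Definition uniform_pr (R : realType) (T : finType) (A : {set T}) : R :=
  #|A|%:R / #|T|%:R.

(* A cycle of s is an element of [porbits s], i.e. the set of points it
   moves around; fixed points give singletons, so they are included. *)
Definition cycle_count (n : nat) (I : {pred nat}) (s : {perm 'I_n}) : nat :=
  #|[set c in porbits s | #|c| \in I]|.

Definition nat_itv (R : realType) (a b : R) : {pred nat} :=
  [pred k : nat | a <= k%:R <= b].

(* Since [ln 0 = 0], the convention 0 log 0 = 0 holds and Q 0 = 1. *)
Definition Q (R : realType) (x : R) : R := x * ln x - x + 1.

(* Main.v *)
Require Import Defs.
From HB Require Import structures.
From mathcomp Require Import all_boot all_order all_algebra all_fingroup.
From mathcomp Require Import ring lra.
From mathcomp Require Import functions reals normedtype derive realfun sequences exp.
Set Implicit Arguments.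
Unset Strict Implicit.
Unset Printing Implicit Defensive.
Import Order.TTheory GRing.Theory Num.Theory.
Import numFieldNormedType.Exports.
Local Open Scope ring_scope.

(** Both tails are Chernoff bounds, and the work is to bound the moment
    generating function: for fixed z >= 0 and L = ln (b / a), the mean of
    z ^+ C_I(s) over the permutations s of n points is O(exp ((z - 1) L)), with
    a constant bounded for z in a bounded set. Taking z = lam and multiplying by
    exp (- lam L ln lam) gives exactly (b / a) ^ (- Q lam).

    To bound the mean, let w k be z for k in I and 1 otherwise, and let p_m be
    the mean over the permutations of m points of the product of w over the
    cycle lengths, so that p_n is the mean of z ^+ C_I. The length of the cycle
    through a given point is uniform on 1, ..., m, and what remains is a uniform
    permutation of the other points; hence [mean_weight_rec]
      m p_m = w_1 p_(m-1) + w_2 p_(m-2) + ... + w_m p_0.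
    With all w_k <= M this bounds n p_n by M (p_0 + ... + p_(n-1)). The
    truncated generating polynomial F of the p_m satisfies, again by the
    recursion, F' <= W' F on [0, 1], where W = sum_k w_k x^k / k; hence W - ln F
    is nondecreasing there and F(1) <= exp (W(1)) [sum_le_expR]. Finally W(1) is
    the n-th harmonic number plus (z - 1) times the sum of 1 / k over k in I,
    that is, ln n + (z - 1) L up to a bounded error [harmonic_itv], and the
    factor n cancels.

    The recursion is proved for permutations supported in subsets S of one
    fixed finite type, decomposed by the cycle C through a point x of S. It
    needs the number (#|C| - 1)! of cyclic permutations of C, which follows from
    the decomposition itself: with all weights 1 it says how the #|S|!
    permutations of S are distributed, and this determines the numbers of
    cyclic permutations inductively [card_full_cycles].

    The Gaussian form follows from the first two bounds at lam = 1 - d and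
    lam = 1 + d with d = psi / sqrt L, since Q (1 - d) and Q (1 + d) are both at
    least d^2 / 3 for 0 <= d <= 1. *)

(** * Permutations supported in a subset *)

Lemma eq_in_porbit (T : finType) (A : {set T}) (s t : {perm T}) (x : T) :
  {in A, forall y, s y \in A} -> {in A, s =1 t} -> x \in A ->
  porbit s x = porbit t x.
Proof.
move=> sA st xA.
have e i : ((s ^+ i)%g x \in A) /\ (s ^+ i)%g x = (t ^+ i)%g x.
  elim: i => [|i [IA IE]]; first by rewrite !expg0 !perm1.
  by rewrite !expgSr !permM -IE; split; [exact: sA|exact: st].
apply/setP => y; apply/porbitP/porbitP => -[i ->]; exists i.
  exact: (e i).2.
exact/esym/(e i).2.
Qed.

Lemma perm_on_closed (T : finType) (A : {set T}) (s : {perm T}) :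
  perm_on A s -> {in A, forall y, s y \in A}.
Proof. by move=> sA y yA; rewrite perm_closed. Qed.

Lemma mulperm_inl (T : finType) (A : {set T}) (u v : {perm T}) :
  perm_on A u -> perm_on (~: A) v -> {in A, u =1 (u * v)%g}.
Proof.
move=> uA vA y yA; rewrite permM [RHS](out_perm vA) //.
by rewrite inE negbK perm_closed.
Qed.

Lemma mulperm_inr (T : finType) (A : {set T}) (u v : {perm T}) :
  perm_on A u -> {in ~: A, v =1 (u * v)%g}.
Proof. by move=> uA y; rewrite inE => yA; rewrite permM (out_perm uA). Qed.

Section RestrPerm.
Variables (T : finType).
Implicit Types (A S C : {set T}) (s u v : {perm T}).

Lemma porbit_sub S s x : perm_on S s -> x \in S -> porbit s x \subset S.
Proof.
move=> sS xS; apply/subsetP => y /porbitP[i ->].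
elim: i => [|i ih]; first by rewrite expg0 perm1.
by rewrite expgSr permM perm_closed.
Qed.

Lemma astabs_porbit s x : s \in 'N(porbit s x | 'P)%g.
Proof.
rewrite /astabs !inE /=; apply/subsetP => y /porbitP[i ->]; rewrite inE /=.
by rewrite apermE -permM -expgSr mem_porbit.
Qed.

Lemma restr_permM A s : s \in 'N(A | 'P)%g ->
  (restr_perm A s * restr_perm (~: A) s = s)%g.
Proof.
move=> sA; apply/permP => y.
have [yA|yA] := boolP (y \in A).
  rewrite -(mulperm_inl (restr_perm_on A s) (restr_perm_on _ s)) //.
  by rewrite restr_permE.
have yA' : y \in ~: A by rewrite inE.
rewrite -(mulperm_inr _ (restr_perm_on A s)) // restr_permE //.
by rewrite astabsC.
Qed.

Lemma restr_perm_id A s u : {in A, forall y, u y = s y} -> perm_on A u ->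
  restr_perm A s = u.
Proof.
move=> us uA; have sN : s \in 'N(A | 'P)%g.
  rewrite /astabs !inE /=; apply/subsetP => y yA.
  by rewrite inE /= apermE -us // perm_closed.
apply/permP => y; have [yA|yA] := boolP (y \in A); last first.
  by rewrite (out_perm (restr_perm_on A s)) // (out_perm uA).
by rewrite restr_permE // us.
Qed.

End RestrPerm.

(** * Total weight of the permutations of a set *)

Definition full_cycles (T : finType) (C : {set T}) (x : T) :=
  [set u | perm_on C u && (porbit u x == C)].

Section CycleWeight.
Variables (R : numDomainType) (T : finType).
Implicit Types (w : nat -> R) (A S C : {set T}) (s u v : {perm T}).

Definition cycle_weight w S s : R := \prod_(c in porbit s @: S) w #|c|.
Definition total_weight w S : R := \sum_(s | perm_on S s) cycle_weight w S s.

(** A permutation of S whose cycle through x is C is the product of a cyclic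
    permutation of C and an arbitrary permutation of S minus C, in a unique way;
    the factors are its restrictions to C and to the complement of C. *)
Lemma full_cycle_split w S C (x : T) : x \in C -> C \subset S ->
  \sum_(s | perm_on S s && (porbit s x == C)) cycle_weight w S s =
  #|full_cycles C x|%:R * w #|C| * total_weight w (S :\: C).
Proof.
move=> xC CS.
pose h (p : {perm T} * {perm T}) := (p.1 * p.2)%g.
pose h' (s : {perm T}) := (restr_perm C s, restr_perm (~: C) s).
rewrite (reindex_onto h h') /=; last first.
  by move=> s /andP[sS /eqP sC]; rewrite /h /h' restr_permM // -sC astabs_porbit.
rewrite (eq_big (fun p => (p.1 \in full_cycles C x) && perm_on (S :\: C) p.2)
   (fun p => w #|C| * cycle_weight w (S :\: C) p.2)); first last.
- case=> u v /andP[/andP[sS /eqP sC] /eqP[/= eu ev]].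
  have uC : perm_on C u by rewrite -eu restr_perm_on.
  have vC : perm_on (~: C) v by rewrite -ev restr_perm_on.
  rewrite /cycle_weight /h /=.
  have -> : [set porbit (u * v)%g y | y in S] = C |: [set porbit v y | y in S :\: C].
    rewrite -(setID S C) (setIidPr CS) imsetU; congr (_ :|: _).
      apply/setP => c; rewrite inE; apply/imsetP/eqP => [[y yC ->]|->].
        by apply/eqP; rewrite -[X in _ == X]sC eq_porbit_mem sC.
      by exists x.
    rewrite setDUl setDv set0U setDDl setUid.
    apply: eq_in_imset => y; rewrite inE => /andP[yC yS].
    apply/esym/(@eq_in_porbit _ (~: C)); last by rewrite inE.
      exact: perm_on_closed.
    exact: mulperm_inr.
  rewrite big_setU1 //=; apply/imsetP => -[y]; rewrite inE => /andP[yC _] Cy.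
  by rewrite Cy porbit_id in yC.
- case=> u v; rewrite /h /h' /= !inE /=; apply/idP/idP.
    move=> /andP[/andP[sS /eqP sC] /eqP[/= eu ev]].
    have uC : perm_on C u by rewrite -eu restr_perm_on.
    have vC : perm_on (~: C) v by rewrite -ev restr_perm_on.
    rewrite uC /=; apply/andP; split.
      rewrite (@eq_in_porbit _ C _ (u * v)%g) ?sC //.
        exact: perm_on_closed.
      exact: mulperm_inl.
    apply/subsetP => y; rewrite !inE => vy.
    have yC : y \notin C.
      by apply: contraNN vy => yC; rewrite (out_perm vC) // inE negbK.
    rewrite yC /=; apply: contraNT vy => yS.
    have yC' : y \in ~: C by rewrite inE.
    by rewrite (mulperm_inr v uC yC') (out_perm sS).
  move=> /andP[/andP[uC /eqP oC] vS].
  have vC : perm_on (~: C) v.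
    apply/subsetP => y vy; have := subsetP vS y vy.
    by rewrite !inE => /andP[].
  rewrite (restr_perm_id _ uC); last exact: mulperm_inl.
  rewrite (restr_perm_id _ vC); last exact: mulperm_inr.
  rewrite eqxx andbT; apply/andP; split.
    apply: perm_onM; first exact: subset_trans uC CS.
    by apply: subset_trans vS (subsetDl _ _).
  apply/eqP; rewrite -[RHS]oC; apply/esym/(@eq_in_porbit _ C) => //.
    exact: perm_on_closed.
  exact: mulperm_inl.
rewrite -(pair_big (mem (full_cycles C x)) (perm_on (S :\: C))
  (fun u v => w #|C| * cycle_weight w (S :\: C) v)) /=.
by rewrite sumr_const -big_distrr -[LHS]mulr_natl mulrA.
Qed.

Lemma total_weight_rec w S (x : T) : x \in S ->
  total_weight w S = \sum_(C : {set T} | (x \in C) && (C \subset S))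
    #|full_cycles C x|%:R * w #|C| * total_weight w (S :\: C).
Proof.
move=> xS; rewrite /total_weight.
rewrite (partition_big (porbit^~ x) (fun C => (x \in C) && (C \subset S))) /=.
  by apply: eq_bigr => C /andP[xC CS]; rewrite full_cycle_split.
by move=> s sS; rewrite porbit_id porbit_sub.
Qed.

(** Removing x turns the subsets counted on the left into arbitrary subsets of
    S minus x. *)
Lemma sum_subsets_card (h : nat -> R) S (x : T) : x \in S ->
  \sum_(C : {set T} | (x \in C) && (C \subset S)) h #|C| =
  \sum_(k < #|S|) 'C(#|S|.-1, k)%:R * h k.+1.
Proof.
move=> xS.
rewrite (reindex_onto (fun D => x |: D) (fun C => C :\ x)) /=; last first.
  by move=> C /andP[xC _]; rewrite setD1K.
rewrite (eq_big (fun D : {set T} => D \subset S :\ x) (fun D : {set T} => h #|D|.+1)).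
- have cS : (#|S| = #|S :\ x|.+1)%N by rewrite (cardsD1 x S) xS.
  rewrite cS /= (partition_big (fun D : {set T} => inord #|D| : 'I_(#|S :\ x|.+1)) xpredT) //=.
  apply: eq_bigr => k _; rewrite -cards_draws.
  transitivity (\sum_(D in [set A : {set T} | A \subset S :\ x & #|A| == k]) h k.+1).
    apply: eq_big => [D|D].
      rewrite inE; have [DS|//] := boolP (D \subset S :\ x).
      by rewrite -val_eqE /= inordK // ltnS subset_leq_card.
    by case/andP=> DS /eqP <-; rewrite inordK // ltnS subset_leq_card.
  by rewrite sumr_const mulr_natl.
- move=> D; rewrite setU11 /= subUset sub1set xS /= subsetD1.
  have [xD|xD] := boolP (x \in D); last by rewrite setU1K // eqxx.
  rewrite !andbF; apply/negbTE; apply/nandP; right.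
  by apply/eqP => e; rewrite -e setD11 in xD.
move=> D /andP[_ /eqP e]; rewrite cardsU1.
suff -> : x \notin D by [].
by rewrite -e setD11.
Qed.

Lemma total_weight1 S : total_weight (fun=> 1) S = ((#|S|)`!)%:R.
Proof.
rewrite -card_perm -sum1_card natr_sum; apply: eq_bigr => s _.
by rewrite /cycle_weight big1.
Qed.

End CycleWeight.

(** Induction on #|C| through [total_weight_rec] with unit weights: each size
    k < m = #|C| of the cycle through x accounts for (m - 1)! of the m!
    permutations of C, which leaves m! - (m - 1) (m - 1)! = (m - 1)! for the
    full cycles. *)
Lemma card_full_cycles (T : finType) (C : {set T}) (x : T) : x \in C ->
  #|full_cycles C x| = (#|C|.-1)`!.
Proof.
have [m] := ubnP #|C|; elim: m C => // m IH C; rewrite ltnS => Cm xC.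
have := total_weight_rec (fun=> 1 : int) xC.
rewrite (bigD1 C) /=; last by rewrite xC subxx.
rewrite setDv !total_weight1 cards0 fact0 !mulr1.
(* h vanishes at #|C|, so that the sum over all subsets is the sum over the
   proper ones. *)
pose h k : int := if k == #|C| then 0 else (k.-1)`!%:R * (#|C| - k)`!%:R.
rewrite (eq_bigr (fun D : {set T} => h #|D|)); last first.
  move=> D /andP[/andP[xD DC] DneC].
  have DlC : (#|D| < #|C|)%N by rewrite proper_card // properEneq DneC.
  rewrite /h ltn_eqF // IH //; last exact: leq_trans DlC Cm.
  by rewrite mulr1 total_weight1 cardsD (setIidPr DC).
have -> : \sum_(D : {set T} | (x \in D) && (D \subset C) && (D != C)) h #|D| =
   \sum_(D : {set T} | (x \in D) && (D \subset C)) h #|D|.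
  rewrite [RHS](bigD1 C) /=; last by rewrite xC subxx.
  by rewrite {2}/h eqxx add0r.
rewrite sum_subsets_card //.
have [k kE] : exists k, #|C| = k.+1 by exists #|C|.-1; rewrite prednK // (cardsD1 x) xC.
rewrite kE /= big_ord_recr /= {2}/h kE eqxx mulr0 addr0.
rewrite (eq_bigr (fun=> k`!%:R)); last first.
  move=> [i ik] _ /=; rewrite /h kE eqSS ltn_eqF // subSS /= -!natrM mulnA.
  by congr _%:R; rewrite -mulnA bin_fact // ltnW.
rewrite sumr_const card_ord -mulrnA -natrD => /eqP.
by rewrite eqr_nat factS mulSn mulnC eqn_add2r => /eqP.
Qed.

Section WeightOfCard.
Variables (R : numDomainType) (T : finType).
Implicit Types (w : nat -> R) (S C : {set T}).

(** An arbitrary representative of the subsets with m elements; meaningful only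
    for m <= #|T|. *)
Definition set_of_card m : {set T} := odflt set0 [pick D : {set T} | #|D| == m].

Definition weight_of_card w m : R := total_weight w (set_of_card m).

Lemma card_set_of_card m : (m <= #|T|)%N -> #|set_of_card m| = m.
Proof.
move=> mT; rewrite /set_of_card; case: pickP => [D /eqP //|noD].
have : (0 < 'C(#|[set: T]|, m))%N by rewrite bin_gt0 cardsT.
rewrite -cards_draws => /card_gt0P[D]; rewrite inE.
by rewrite noD andbF.
Qed.

(** The recursion expresses the total weight of S through sizes only, once this
    is known for all smaller sets. *)
Lemma total_weight_of_card w S : total_weight w S = weight_of_card w #|S|.
Proof.
have [m] := ubnP #|S|; elim: m S => // m IH S; rewrite ltnS => Sm.
pose v k := w k * (k.-1)`!%:R * weight_of_card w (#|S| - k)%N.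
have recS S' : #|S'| = #|S| -> S' != set0 ->
    total_weight w S' = \sum_(k < #|S|) 'C(#|S|.-1, k)%:R * v k.+1.
  move=> eS' /set0Pn[y yS']; rewrite (total_weight_rec w yS') -eS'.
  rewrite -(sum_subsets_card v yS'); apply: eq_bigr => C /andP[yC CS'].
  have cC : #|S' :\: C| = (#|S| - #|C|)%N by rewrite cardsD (setIidPr CS') eS'.
  rewrite card_full_cycles // IH cC; first by rewrite /v (mulrC (w _)).
  apply: leq_trans Sm; rewrite ltn_subrL -eS' !card_gt0.
  by apply/andP; split; apply/set0Pn; exists y.
have cS : #|set_of_card #|S| | = #|S| by rewrite card_set_of_card ?max_card.
have [S0|S0] := eqVneq S set0.
  rewrite /weight_of_card; congr total_weight; apply/esym/eqP.
  by rewrite [X in _ == X]S0 -cards_eq0 cS S0 cards0.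
rewrite (recS S) // /weight_of_card recS //.
by rewrite -card_gt0 cS card_gt0.
Qed.

Definition mean_weight w m : R := weight_of_card w m / m`!%:R.

End WeightOfCard.

Section MeanWeight.
Variables (R : numFieldType) (T : finType) (w : nat -> R).
Local Notation p := (mean_weight T w).

Lemma mean_weight0 : p 0%N = 1.
Proof.
rewrite /mean_weight -(cards0 T) -total_weight_of_card cards0 fact0 divr1.
rewrite /total_weight (big_pred1 1%g) => [|s /=].
  by rewrite /cycle_weight imset0 big_set0.
apply/idP/eqP => [s0|->]; last exact: perm_on1.
by apply/permP => x; rewrite (out_perm s0) ?inE // perm1.
Qed.

Lemma mean_weight_ge0 m : (forall k, 0 <= w k) -> 0 <= p m.
Proof.
move=> w0; rewrite divr_ge0 // sumr_ge0 // => s _.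
by apply: prodr_ge0 => c _.
Qed.

(** Since 'C(m, k) k! (m - k)! = m!, dividing the recursion for total weights by
    m! removes all factorials: the cycle through a given point has a uniformly
    distributed length. *)
Lemma mean_weight_rec m : (m < #|T|)%N ->
  m.+1%:R * p m.+1 = \sum_(k < m.+1) w k.+1 * p (m - k)%N.
Proof.
move=> mT; have cS := card_set_of_card mT.
have [x xS] : exists x, x \in set_of_card T m.+1 by apply/card_gt0P; rewrite cS.
pose h k := (k.-1)`!%:R * w k * weight_of_card T w (m.+1 - k)%N.
have fN0 k : k`!%:R != 0 :> R by rewrite pnatr_eq0 -lt0n fact_gt0.
have -> : m.+1%:R * p m.+1 = total_weight w (set_of_card T m.+1) / m`!%:R.
  rewrite /mean_weight /weight_of_card factS natrM.
  by rewrite invfM mulrCA mulVKf // pnatr_eq0.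
rewrite (total_weight_rec w xS) (eq_bigr (fun C : {set T} => h #|C|)).
  rewrite (sum_subsets_card h xS) cS mulr_suml; apply: eq_bigr => -[k km] _ /=.
  rewrite /h subSS /mean_weight /= -(bin_fact (ltnSE km)) !natrM.
  rewrite -!mulrA; field.
  by rewrite !fN0 pnatr_eq0 -lt0n bin_gt0 -ltnS km.
move=> C /andP[xC CS]; rewrite card_full_cycles // /h total_weight_of_card.
by rewrite cardsD (setIidPr CS) cS.
Qed.

End MeanWeight.

(** * Monotonicity arguments *)

Section Analysis.
Variable R : realType.

Lemma is_derive_le (f df : R -> R) (a b : R) : a <= b ->
  (forall x, a <= x <= b -> is_derive x 1 f (df x)) ->
  (forall x, a <= x <= b -> 0 <= df x) -> f a <= f b.
Proof.
move=> ab fd df0.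
have ab' x : x \in `]a, b[%R -> a <= x <= b.
  by rewrite in_itv /= => /andP[/ltW-> /ltW->].
apply: (@ger0_derive1_ndecr _ f a b) => //.
- by move=> x /ab' xab; case: (fd x xab).
- by move=> x /ab' xab; rewrite derive1E; case: (fd x xab) => _ ->; exact: df0.
apply: derivable_within_continuous => x; rewrite in_itv /= => xab.
by case: (fd x xab).
Qed.

Lemma is_derive_horner (p : {poly R}) (x : R) :
  is_derive x 1 (horner p) (p^`()).[x].
Proof.
by apply: DeriveDef; [exact: derivable_horner|rewrite -derive1E -derivE].
Qed.

Lemma horner_ge0 (p : {poly R}) (x : R) :
  (forall i, 0 <= p`_i) -> 0 <= x -> 0 <= p.[x].
Proof.
move=> p0 x0; rewrite horner_coef sumr_ge0 // => i _.
by rewrite mulr_ge0 // exprn_ge0.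
Qed.

(** Let F be the generating polynomial of p up to degree n and W the polynomial
    with coefficients w_k / k. The recursion says that F' and W' F have the same
    coefficients below degree n, and those of W' F are nonnegative beyond. So
    F' <= W' F on the nonnegative axis, and W - ln F is nondecreasing on
    [0, 1]. *)
Lemma sum_le_expR (n : nat) (w p : nat -> R) :
  (forall k, 0 <= w k) -> (forall k, 0 <= p k) -> p 0%N = 1 ->
  (forall m, (m < n)%N -> m.+1%:R * p m.+1 = \sum_(k < m.+1) w k.+1 * p (m - k)%N) ->
  \sum_(j < n.+1) p j <= expR (\sum_(k < n) w k.+1 / k.+1%:R).
Proof.
move=> w0 p0 p1 rec.
pose F : {poly R} := \poly_(j < n.+1) p j.
pose W : {poly R} := \poly_(k < n.+1) (w k / k%:R).
have F1 x : 0 <= x -> 1 <= F.[x].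
  move=> x0; rewrite horner_poly big_ord_recl expr0 mulr1 p1 lerDl.
  by rewrite sumr_ge0 // => i _; rewrite mulr_ge0 // exprn_ge0.
have dW k : (k < n)%N -> (W^`())`_k = w k.+1.
  by move=> kn; rewrite coef_deriv coef_poly ltnS kn -[LHS]mulr_natr mulfVK // pnatr_eq0.
have dWF x : 0 <= x -> (F^`()).[x] <= (W^`()).[x] * F.[x].
  move=> x0; rewrite -hornerM -subr_ge0 -hornerN -hornerD.
  apply: horner_ge0 => // j; rewrite coefB coefM subr_ge0.
  have [jn|jn] := ltnP j n; last first.
    rewrite coef_deriv coef_poly ltnS ltnNge jn /= mul0rn.
    apply: sumr_ge0 => i _; rewrite coef_deriv !coef_poly.
    by apply: mulr_ge0; [rewrite mulrn_wge0 //|]; case: ifP => // _; rewrite divr_ge0.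
  rewrite coef_deriv coef_poly ltnS jn -[leLHS]mulr_natl rec //.
  apply: ler_sum => -[k kj] _ /=; rewrite dW; last by apply: leq_trans jn.
  by rewrite coef_poly ifT // ltnS (leq_trans (leq_subr _ _)) // ltnW.
have : W.[0] - ln F.[0] <= W.[1] - ln F.[1].
  apply: (@is_derive_le (horner W - (@ln R \o horner F))
     (fun x => (W^`()).[x] - (F.[x]^-1 * (F^`()).[x]))) => // x /andP[x0 _].
    have F0 : 0 < F.[x] by apply: lt_le_trans (F1 x x0).
    exact: (is_deriveB (is_derive_horner W x)
      (is_derive1_comp (is_derive1_ln F0) (is_derive_horner F x))).
  have F0 : 0 < F.[x] by apply: lt_le_trans (F1 x x0).
  by rewrite subr_ge0 mulrC ler_pdivrMr // dWF.
have -> : W.[0] = 0 by rewrite horner_coef0 coef_poly /= invr0 mulr0.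
have -> : F.[0] = 1 by rewrite horner_coef0 coef_poly.
rewrite ln1 subr0 subr_ge0.
have -> : W.[1] = \sum_(k < n) w k.+1 / k.+1%:R.
  rewrite horner_poly big_ord_recl /= invr0 mulr0 mul0r add0r.
  by apply: eq_bigr => i _; rewrite expr1n mulr1.
have -> : \sum_(j < n.+1) p j = F.[1].
  by rewrite horner_poly; apply: eq_bigr => i _; rewrite expr1n mulr1.
by rewrite -ler_expR lnK // posrE; apply: lt_le_trans (F1 1 ler01).
Qed.

(** The difference of the two sides vanishes at 1 and has derivative
    (x - 1)^2 / (x (x + 1)^2). *)
Lemma ln_ge_div (x : R) : 1 <= x -> 2 * (x - 1) / (x + 1) <= ln x.
Proof.
move=> x1.
pose f : R -> R := @ln R + (cst 4 * (fun y => (y + 1)^-1)).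
have : f 1 <= f x.
  pose df (y : R) : R := y^-1 - 4 / (y + 1) ^+ 2.
  have fd : forall y, 1 <= y <= x -> is_derive y 1 f (df y).
    move=> y /andP[y1 _].
    have y0 : 0 < y by lra.
    have d1 : is_derive y 1 (fun z : R => z + 1) 1.
      have := is_deriveD (is_derive_id y (1 : R)) (is_derive_cst (1 : R) y 1).
      by rewrite addr0.
    have y10 : y + 1 != 0 by apply: lt0r_neq0; lra.
    have dv := @is_deriveV R (fun z => z + 1) y 1 1 y10 d1.
    apply: (@is_derive_eq _ _ _ _ _ _ _ _ (is_deriveD (is_derive1_ln y0)
      (is_deriveM (is_derive_cst (4 : R) y 1) dv))).
    rewrite /df /cst /= scaler0 addr0 /GRing.scale /= mulr1; field; lra.
  apply: (is_derive_le x1 fd) => y /andP[y1 _].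
  have -> : df y = (y - 1) ^+ 2 / (y * (y + 1) ^+ 2).
    by rewrite /df; field; lra.
  by rewrite divr_ge0 ?sqr_ge0 // mulr_ge0 ?sqr_ge0; lra.
rewrite (_ : f 1 = ln 1 + 4 * (1 + 1)^-1) // (_ : f x = ln x + 4 * (x + 1)^-1) //.
rewrite ln1 add0r (_ : 4 * (1 + 1)^-1 = 2 :> R); last by field.
have -> : 2 * (x - 1) / (x + 1) = 2 - 4 * (x + 1)^-1 by field; lra.
lra.
Qed.

(** By [ln_ge_div], Q (1 + d) >= d^2 / (2 + d). *)
Lemma Q_ge_right (d : R) : 0 <= d <= 1 -> d ^+ 2 / 3 <= Q (1 + d).
Proof.
move=> /andP[d0 d1]; have := @ln_ge_div (1 + d); rewrite lerDl => /(_ d0) h.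
rewrite /Q.
have : (1 + d) * (2 * (1 + d - 1) / (1 + d + 1)) <= (1 + d) * ln (1 + d).
  by apply: ler_wpM2l => //; lra.
suff : d ^+ 2 / 3 <= (1 + d) * (2 * (1 + d - 1) / (1 + d + 1)) - d by lra.
have -> : (1 + d) * (2 * (1 + d - 1) / (1 + d + 1)) - d = d ^+ 2 / (2 + d).
  by field; lra.
rewrite ler_wpM2l ?sqr_ge0 // lef_pV2 ?posrE; lra.
Qed.

(** The stronger bound d^2 / 2 holds: (1 - y)^2 / 2 - Q y vanishes at y = 1, and
    its derivative y - 1 - ln y is nonnegative. The value d = 1 is treated apart,
    since ln is not differentiable at 0. *)
Lemma Q_ge_left (d : R) : 0 <= d <= 1 -> d ^+ 2 / 3 <= Q (1 - d).
Proof.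
move=> /andP[d0]; rewrite le_eqVlt => /predU1P[->|d1].
  by rewrite /Q subrr mul0r subrr add0r expr1n; lra.
suff : 2^-1 * (1 - (1 - d)) ^+ 2 - Q (1 - d) <= 2^-1 * (1 - 1) ^+ 2 - Q 1.
  by rewrite {2}/Q ln1 mulr0 add0r addNr subrr expr0n /=; nra.
apply: (@is_derive_le (fun y => 2^-1 * (1 - y) ^+ 2 - Q y)
  (fun y => - (1 - y) - ln y)) => [|y /andP[y1 _]|y /andP[y1 _]]; first by lra.
  have y0 : 0 < y by lra.
  have dl := is_derive1_ln y0.
  apply: is_derive_eq.
  by rewrite /GRing.scale /=; field; lra.
have := @le_ln1Dx R (y - 1); rewrite (_ : 1 + (y - 1) = y); last by ring.
by lra.
Qed.

(** * Harmonic sums *)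

Lemma ln_ratio_bounds (k : nat) : (0 < k)%N ->
  k.+1%:R^-1 <= ln (k.+1%:R / k%:R : R) <= k%:R^-1.
Proof.
move=> k0; have k0' : 0 < k%:R :> R by rewrite ltr0n.
apply/andP; split.
  rewrite -[ln _]opprK -lnV ?posrE ?divr_gt0 // invf_div.
  have -> : k%:R / k.+1%:R = 1 + (- k.+1%:R^-1) :> R by field; lra.
  rewrite lerNr; apply: le_ln1Dx; rewrite ltrN2 invf_lt1 ?ltr1n //.
have -> : k.+1%:R / k%:R = 1 + k%:R^-1 :> R by field; lra.
by apply: le_ln1Dx; apply: lt_le_trans (_ : 0 <= _); rewrite ?invr_ge0 //; lra.
Qed.

Lemma harmonic_lower (A B : nat) : (0 < A <= B)%N ->
  ln (B%:R / A%:R) <= \sum_(A <= k < B) k%:R^-1 :> R.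
Proof.
case/andP=> A0 AB; rewrite -(subnKC AB); elim: (B - A)%N => [|m IH].
  by rewrite addn0 big_geq // divff ?ln1 // pnatr_eq0 -lt0n.
rewrite addnS big_nat_recr ?leq_addr //=.
have A0' : 0 < A%:R :> R by rewrite ltr0n.
have m0 : 0 < (A + m)%:R :> R by rewrite ltr0n addn_gt0 A0.
have -> : (A + m).+1%:R / A%:R = (A + m)%:R / A%:R * ((A + m).+1%:R / (A + m)%:R) :> R.
  by field; lra.
rewrite lnM ?posrE ?divr_gt0 //; apply: lerD => //.
by have /andP[] := ln_ratio_bounds (ltn_addr m A0).
Qed.

Lemma harmonic_upper (A B : nat) : (0 < A <= B)%N ->
  \sum_(A <= k < B.+1) k%:R^-1 <= A%:R^-1 + ln (B%:R / A%:R) :> R.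
Proof.
case/andP=> A0 AB; rewrite -(subnKC AB); elim: (B - A)%N => [|m IH].
  by rewrite addn0 big_nat1 // divff ?ln1 ?addr0 // pnatr_eq0 -lt0n.
rewrite addnS big_nat_recr ?(leq_trans (leq_addr m A)) //=.
have A0' : 0 < A%:R :> R by rewrite ltr0n.
have m0 : 0 < (A + m)%:R :> R by rewrite ltr0n addn_gt0 A0.
have -> : (A + m).+1%:R / A%:R = (A + m)%:R / A%:R * ((A + m).+1%:R / (A + m)%:R) :> R.
  by field; lra.
rewrite lnM ?posrE ?divr_gt0 // addrA; apply: lerD => //.
by have /andP[] := ln_ratio_bounds (ltn_addr m A0).
Qed.

(** Let A be the least integer >= a and B the integer part of b. The sum is at
    least ln ((B + 1) / A), where B + 1 > b and ln (A / a) <= A / a - 1 <= 1, and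
    at most 1 / A + ln (B / A), where A >= a, B <= b. An interval without
    integers (A = B + 1) is covered by the first estimate and makes the second
    trivial. *)
Lemma harmonic_itv (n : nat) (a b : R) : 1 <= a -> a < b -> b <= n%:R ->
  `| \sum_(k < n) (k.+1 \in nat_itv a b)%:R / k.+1%:R - ln (b / a) | <= 1.
Proof.
move=> a1 ab bn.
have a0 : 0 < a by lra.
have b0 : 0 < b by lra.
have exA : exists m : nat, a <= m%:R by exists n; lra.
case: (ex_minnP exA) => A aA minA.
have leA k : (a <= k%:R) = (A <= k)%N.
  apply/idP/idP => [/minA //|Ak]; apply: le_trans aA _; by rewrite ler_nat.
have A0 : (0 < A)%N by rewrite lt0n; apply: contraTneq aA => ->; rewrite -ltNge; lra.
have Aa : A%:R <= a + 1.
  have : ~~ (a <= A.-1%:R) by rewrite leA -ltnNge prednK.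
  by rewrite -ltNge => /ltW; rewrite -{2}(prednK A0) -addn1 natrD; lra.
pose B := Num.truncn b.
have leB k : (k%:R <= b) = (k <= B)%N by rewrite truncn_ge_nat // ltW.
have /andP[Bb bB] : B%:R <= b < B.+1%:R by apply: truncn_itv; exact: ltW.
have AB : (A <= B.+1)%N by rewrite -leA; lra.
have Bn : (B <= n)%N by rewrite -(ler_nat R); lra.
have -> : \sum_(k < n) (k.+1 \in nat_itv a b)%:R / k.+1%:R =
   \sum_(A <= k < B.+1) k%:R^-1 :> R.
  rewrite -(big_mkord xpredT (fun k => (k.+1 \in nat_itv a b)%:R / k.+1%:R)).
  rewrite -(big_add1 _ _ 0 n.+1 xpredT (fun k => (k \in nat_itv a b)%:R / k%:R)) /=.
  rewrite (@big_cat_nat _ _ _ B.+1) //= (@big_cat_nat _ _ _ A 1 B.+1) //=.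
  rewrite [X in X + _ + _]big_nat_cond [X in X + _ + _]big1 ?add0r; last first.
    move=> k /andP[/andP[_ kA] _].
    by rewrite /nat_itv inE leA leqNgt kA mul0r.
  rewrite [X in _ + X]big_nat_cond [X in _ + X]big1 ?addr0; last first.
    move=> k /andP[/andP[kB _] _].
    by rewrite /nat_itv inE leB leqNgt kB andbF mul0r.
  apply: eq_big_nat => k /andP[Ak kB].
  by rewrite /nat_itv inE leA leB Ak -ltnS kB mul1r.
have A0' : 0 < A%:R :> R by rewrite ltr0n.
have A1' : 1 <= A%:R :> R by rewrite ler1n.
have lba : 0 <= ln (b / a) by rewrite ln_ge0 // ler_pdivlMr // mul1r ltW.
rewrite ler_distl; apply/andP; split.
  have : ln (B.+1%:R / A%:R) <= \sum_(A <= k < B.+1) k%:R^-1 :> R.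
    by apply: harmonic_lower; rewrite A0.
  apply: le_trans.
  have -> : b / a = (b / A%:R) * (1 + (A%:R - a) / a) by field; lra.
  have Aa0 : 0 <= (A%:R - a) / a by rewrite divr_ge0 ?subr_ge0 // ltW.
  have Aa1 : (A%:R - a) / a <= 1 by rewrite ler_pdivrMr //; lra.
  rewrite lnM ?posrE ?divr_gt0 //; last by lra.
  have : ln (1 + (A%:R - a) / a) <= (A%:R - a) / a by apply: le_ln1Dx; lra.
  have : ln (b / A%:R) <= ln (B.+1%:R / A%:R).
    rewrite ler_ln ?posrE ?divr_gt0 ?ltr0Sn //.
    by apply: ler_wpM2r; [rewrite invr_ge0 ltW|exact: ltW].
  by lra.
have [AeB|AB'] := leqP B.+1 A.
  by rewrite big_geq //; lra.
have /le_trans -> // : \sum_(A <= k < B.+1) k%:R^-1 <= A%:R^-1 + ln (B%:R / A%:R) :> R.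
  by apply: harmonic_upper; rewrite A0.
rewrite addrC; apply: lerD; last by rewrite invf_le1.
have B0 : 0 < B%:R :> R by rewrite ltr0n (leq_trans A0).
rewrite ler_ln ?posrE ?divr_gt0 //.
by apply: ler_pM; rewrite ?invr_ge0 ?ler0n // lef_pV2 ?posrE.
Qed.

End Analysis.

(** * Moment generating function and tails *)

Section Tails.
Variable R : realType.
Implicit Types (a b z : R) (n : nat).

Lemma perm_onT (T : finType) (s : {perm T}) : perm_on [set: T] s.
Proof. by apply/subsetP => x; rewrite inE. Qed.

Lemma card_perm_type (T : finType) : #|{perm T}| = (#|T|)`!.
Proof.
rewrite -[in RHS](cardsT T) -card_perm; apply: eq_card => s.
by rewrite inE unfold_in [RHS]perm_onT.
Qed.

Definition itv_weight a b z (k : nat) : R := if k \in nat_itv a b then z else 1.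

Lemma mean_cycle_count n a b z :
  (\sum_(s : {perm 'I_n}) z ^+ cycle_count (nat_itv a b) s) / n`!%:R =
  mean_weight 'I_n (itv_weight a b z) n.
Proof.
rewrite /mean_weight -[n in weight_of_card _ _ n]card_ord -cardsT.
rewrite -total_weight_of_card; congr (_ / _); apply: eq_big => [s|s _].
  by rewrite perm_onT.
rewrite /cycle_weight (_ : porbit s @: _ = porbits s); last first.
  by apply/setP => c; apply/imsetP/imsetP => -[x _ ->]; exists x; rewrite ?inE.
rewrite /cycle_count /itv_weight -big_mkcondr /= -prodr_const.
by apply: eq_bigl => c; rewrite inE.
Qed.

(** With n = #|T| and p_m for [mean_weight T w m], the recursion bounds n p_n by
    M (p_0 + ... + p_(n-1)), and [sum_le_expR] bounds this sum. *)
Lemma mean_weight_le (T : finType) (w : nat -> R) (M : R) :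
  (0 < #|T|)%N -> (forall k, 0 <= w k <= M) ->
  mean_weight T w #|T| <= M * expR (\sum_(k < #|T|) w k.+1 / k.+1%:R) / #|T|%:R.
Proof.
move=> T0 wM; have w0 k : 0 <= w k by case/andP: (wM k).
have p0 k : 0 <= mean_weight T w k by apply: mean_weight_ge0.
have M0 : 0 <= M by case/andP: (wM 0%N) => /le_trans h /h.
rewrite ler_pdivlMr ?ltr0n // mulrC.
have := @sum_le_expR R #|T| w (mean_weight T w) w0 p0 (mean_weight0 T w) (@mean_weight_rec _ _ w).
have [m Tm] : exists m, #|T| = m.+1 by exists #|T|.-1; rewrite prednK.
move/(ler_wpM2l M0); apply: le_trans.
rewrite [in leLHS]Tm mean_weight_rec ?Tm //.
rewrite [in leRHS]big_ord_recr /= mulrDr.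
apply: ler_wpDr; first by rewrite mulr_ge0.
rewrite mulr_sumr [leRHS](reindex_inj rev_ord_inj) /=.
by apply: ler_sum => k _; rewrite subSS ler_wpM2r //; case/andP: (wM k.+1).
Qed.

(** In [mean_weight_le] the exponent is the n-th harmonic number, at most
    1 + ln n, plus z - 1 times a sum within 1 of ln (b / a); the error terms make
    up the factor expR (1 + `|z - 1|). *)
Lemma mgf_cycle_count n a b z :
  (0 < n)%N -> 1 <= a -> a < b -> b <= n%:R -> 0 <= z ->
  (\sum_(s : {perm 'I_n}) z ^+ cycle_count (nat_itv a b) s) / n`!%:R <=
  Num.max 1 z * expR (1 + `|z - 1|) * expR ((z - 1) * ln (b / a)).
Proof.
move=> n0 a1 ab bn z0; rewrite mean_cycle_count.
have n0' : 0 < n%:R :> R by rewrite ltr0n.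
have := @mean_weight_le 'I_n (itv_weight a b z) (Num.max 1 z).
rewrite card_ord n0 => /(_ isT) h.
have {}h := h _.
have wM k : 0 <= itv_weight a b z k <= Num.max 1 z.
  by rewrite /itv_weight; case: ifP => _; rewrite ?z0 ?ler01 le_max lexx ?orbT.
apply: (le_trans (h wM)); rewrite -!mulrA ler_wpM2l //.
  by rewrite le_max ler01.
rewrite ler_pdivrMr // -[X in _ <= _ * X](lnK n0') -!expRD ler_expR.
have -> : \sum_(k < n) itv_weight a b z k.+1 / k.+1%:R =
   \sum_(k < n) k.+1%:R^-1 + (z - 1) * \sum_(k < n) (k.+1 \in nat_itv a b)%:R / k.+1%:R.
  rewrite mulr_sumr -big_split /=; apply: eq_bigr => k _.
  rewrite /itv_weight; case: ifP => _ /=.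
    by rewrite div1r mulrBl mul1r addrC subrK.
  by rewrite mul0r mulr0 addr0 div1r.
have Hn : \sum_(k < n) k.+1%:R^-1 <= 1 + ln n%:R :> R.
  rewrite -(big_mkord xpredT (fun k => k.+1%:R^-1 : R)).
  rewrite -(big_add1 _ _ 0 n.+1 xpredT (fun k => k%:R^-1 : R)) /=.
  by have := @harmonic_upper R 1 n; rewrite n0 divr1 invr1; apply.
have := harmonic_itv a1 ab bn; set H := \sum_(k < n) _ => hH.
have : (z - 1) * (H - ln (b / a)) <= `|z - 1|.
  by rewrite (le_trans (ler_norm _)) // normrM ler_piMr.
by move: (ln n%:R) (ln (b / a)) Hn => l1 l2; lra.
Qed.

(** Markov's inequality for z ^+ C_I. For z <= 1 the hypothesis holds on the
    lower tail and for z >= 1 on the upper tail, at the threshold z L; since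
    ln 0 = 0 this includes z = 0, where it says that C_I vanishes on A. *)
Lemma chernoff_cycle_count n a b z (A : {set {perm 'I_n}}) :
  (0 < n)%N -> 1 <= a -> a < b -> b <= n%:R -> 0 <= z ->
  (forall s, s \in A ->
     expR (z * ln (b / a) * ln z) <= z ^+ cycle_count (nat_itv a b) s) ->
  uniform_pr R A <= Num.max 1 z * expR (1 + `|z - 1|) * (b / a) `^ (- Q z).
Proof.
move=> n0 a1 ab bn z0 hA; set t := z * _ * _ in hA.
have ba0 : b / a != 0 by rewrite gt_eqF // divr_gt0; lra.
have -> : (b / a) `^ (- Q z) = expR ((z - 1) * ln (b / a)) * expR (- t).
  rewrite /powR (negbTE ba0) -expRD; congr expR; rewrite /Q /t; ring.
rewrite mulrA; apply: (le_trans _ (ler_wpM2r (expR_ge0 _) (mgf_cycle_count n0 a1 ab bn z0))).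
rewrite expRN ler_pdivlMr ?expR_gt0 // /uniform_pr card_perm_type card_ord mulrAC.
rewrite ler_wpM2r ?invr_ge0 ?ler0n //.
rewrite mulr_natl -sumr_const [leRHS](bigID (mem A)) /= ler_wpDr //.
  by apply: sumr_ge0 => s _; rewrite exprn_ge0.
exact: ler_sum.
Qed.

Lemma expR_ln_X z k : 0 < z -> z ^+ k = expR (k%:R * ln z).
Proof. by move=> z0; rewrite expRM_natl lnK. Qed.

Lemma lower_tail n a b z :
  (0 < n)%N -> 1 <= a -> a < b -> b <= n%:R -> 0 <= z <= 1 ->
  uniform_pr R [set s : {perm 'I_n} |
      (cycle_count (nat_itv a b) s)%:R <= z * ln (b / a)]
    <= expR 2 * (b / a) `^ (- Q z).
Proof.
move=> n0 a1 ab bn /andP[z0 z1].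
apply: le_trans (chernoff_cycle_count n0 a1 ab bn z0 _) _.
  move=> s; rewrite inE => sA.
  move: z0; rewrite le_eqVlt => /predU1P[ze|z0].
    move: sA; rewrite -ze mul0r lern0 => /eqP ->.
    by rewrite mul0r expR0 expr0.
  by rewrite expR_ln_X // ler_expR ler_wnM2r // ln_le0.
rewrite ler_wpM2r ?powR_ge0 // (max_idPl z1) mul1r ler_expR.
by rewrite ler0_norm; lra.
Qed.

Lemma upper_tail n a b z z0 :
  (0 < n)%N -> 1 <= a -> a < b -> b <= n%:R -> 1 <= z <= z0 ->
  uniform_pr R [set s : {perm 'I_n} |
      (cycle_count (nat_itv a b) s)%:R >= z * ln (b / a)]
    <= z0 * expR z0 * (b / a) `^ (- Q z).
Proof.
move=> n0 a1 ab bn /andP[z1 zz0]; have zp : 0 < z by lra.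
apply: le_trans (chernoff_cycle_count n0 a1 ab bn (ltW zp) _) _.
  move=> s; rewrite inE => sA.
  by rewrite expR_ln_X // ler_expR ler_wpM2r // ln_ge0.
rewrite ler_wpM2r ?powR_ge0 // (max_idPr z1).
apply: ler_pM; rewrite ?expR_ge0 ?(ltW zp) // ler_expR.
by rewrite ger0_norm; lra.
Qed.

End Tails.

Theorem theorem1p8 (R : realType) :
  (exists2 C : R, 0 < C &
    forall (n : nat) (a b lam : R),
      (0 < n)%N -> 1 <= a -> a < b -> b <= n%:R ->
      0 <= lam <= 1 ->
      uniform_pr R [set s : {perm 'I_n} |
          (cycle_count (nat_itv a b) s)%:R <= lam * ln (b / a)]
        <= C * (b / a) `^ (- Q lam))
  /\
  (forall lam0 : R, 1 < lam0 ->
    exists2 C : R, 0 < C &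
    forall (n : nat) (a b lam : R),
      (0 < n)%N -> 1 <= a -> a < b -> b <= n%:R ->
      1 <= lam <= lam0 ->
      uniform_pr R [set s : {perm 'I_n} |
          (cycle_count (nat_itv a b) s)%:R >= lam * ln (b / a)]
        <= C * (b / a) `^ (- Q lam))
  /\
  (exists2 C : R, 0 < C &
    forall (n : nat) (a b psi : R),
      (0 < n)%N -> 1 <= a -> a < b -> b <= n%:R ->
      0 <= psi <= Num.sqrt (ln (b / a)) ->
      uniform_pr R [set s : {perm 'I_n} |
          `|(cycle_count (nat_itv a b) s)%:R - ln (b / a)|
            >= psi * Num.sqrt (ln (b / a))]
        <= C * expR (- (psi ^+ 2 / 3))).
Proof.
split; first by exists (expR 2); [exact: expR_gt0|exact: lower_tail].
split.
  move=> lam0 l1; exists (lam0 * expR lam0); last by move=> *; exact: upper_tail.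
  by rewrite mulr_gt0 ?expR_gt0; lra.
exists (expR 2 + 2 * expR 2); first by have := expR_gt0 (2 : R); lra.
move=> n a b psi n0 a1 ab bn /andP[psi0 psi1].
have ba1 : 1 < b / a by rewrite ltr_pdivlMr; lra.
set L := ln (b / a) in psi1 *; have L0 : 0 < L by rewrite ln_gt0.
have sL : 0 < Num.sqrt L by rewrite sqrtr_gt0.
pose d := psi / Num.sqrt L.
have d01 : 0 <= d <= 1 by rewrite divr_ge0 ?(ltW sL) // ler_pdivrMr // mul1r.
have dL : psi * Num.sqrt L = d * L.
  by rewrite /d -[X in _ = _ * X](sqr_sqrtr (ltW L0)); field; rewrite gt_eqF.
have psiE : psi ^+ 2 = d ^+ 2 * L.
  by rewrite /d -[X in _ = _ * X](sqr_sqrtr (ltW L0)); field; rewrite gt_eqF.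
have decay y : d ^+ 2 / 3 <= Q y -> (b / a) `^ (- Q y) <= expR (- (psi ^+ 2 / 3)).
  move=> dQ; rewrite /powR gt_eqF; last by lra.
  rewrite ler_expR -/L mulNr lerN2 psiE mulrAC.
  by rewrite ler_wpM2r // ltW.
have /andP[d0 d1] := d01.
have low : 0 <= 1 - d <= 1 by lra.
have upp : 1 <= 1 + d <= 2 by lra.
rewrite mulrDl.
apply: (le_trans _ (lerD
  (le_trans (lower_tail n0 a1 ab bn low) (ler_wpM2l _ (decay _ (Q_ge_left d01))))
  (le_trans (upper_tail n0 a1 ab bn upp) (ler_wpM2l _ (decay _ (Q_ge_right d01)))))).
- rewrite /uniform_pr -mulrDl ler_wpM2r ?invr_ge0 // -natrD ler_nat.
  apply: leq_trans (leq_card_setU _ _).1; apply: subset_leq_card.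
  apply/subsetP => s; rewrite !inE dL ler_normr => /orP[h|h]; apply/orP.
    by right; rewrite -/L; lra.
  by left; rewrite -/L; lra.
- exact: expR_ge0.
- by rewrite mulr_ge0 ?expR_ge0.
Qed.
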